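(* Let $f_0\colon\mathbb{R}^n\to\mathbb{R}$ and $F\colon\mathbb{R}^n\to\mathbb{R}^m$ be twice continuously differentiable, let $g\colon\mathbb{R}^m\to\overline{\mathbb{R}}$ be proper and lower semicontinuous, and consider the problem $\min\{f_0(x)+g(F(x))\mid x\in\mathbb{R}^n\}$. Let $\bar x\in\mathbb{R}^n$ be a point with $|g(F(\bar x))|<\infty$. Assume that for each $u\in\mathcal{C}(\bar x)\setminus\{0\}$ there exists a multiplier $\lambda\in\Lambda(\bar x)$ such that $$\nabla^2_{xx}L(\bar x,\lambda)(u,u)+\mathrm{d}^2g(F(\bar x);\lambda)(\nabla F(\bar x)u)>0.$$ Then the second-order growth condition holds for $f_0+g\circ F$ at $\bar x$. Particularly, $\bar x$ is a strict local minimizer of the problem.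
   Context: $\overline{\mathbb{R}}:=\mathbb{R}\cup\{-\infty,\infty\}$; a function is proper if it never takes the value $-\infty$ and is finite somewhere. $L(x,\lambda):=f_0(x)+\langle\lambda,F(x)\rangle$, $\Lambda(\bar x):=\{\lambda\in\mathbb{R}^m\mid\nabla_xL(\bar x,\lambda)=0\}$, and the critical cone is $\mathcal{C}(\bar x):=\{u\in\mathbb{R}^n\mid\langle\nabla f_0(\bar x),u\rangle+\mathrm{d}g(F(\bar x))(\nabla F(\bar x)u)\le0\}$. $\nabla^2_{xx}L(\bar x,\lambda)(u,u):=u^\top\nabla^2_{xx}L(\bar x,\lambda)u$. For lower semicontinuous $h$ with $|h(\bar z)|<\infty$: $\mathrm{d}h(\bar z)(w):=\liminf_{t\downarrow0,\,w'\to w}\frac{h(\bar z+tw')-h(\bar z)}{t}$ and $\mathrm{d}^2h(\bar z;z^* )(w):=\liminf_{t\downarrow0,\,w'\to w}\frac{h(\bar z+tw')-h(\bar z)-t\langle z^*,w'\rangle}{\frac12t^2}$. The second-order growth condition holds for $h$ at $\bar z$ if there are $\varepsilon>0$, $\delta>0$ with $h(z)\ge h(\bar z)+\varepsilon\|z-\bar z\|^2$ for all $z$ with $\|z-\bar z\|\le\delta$. *)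

(* Defs.v *)
From HB Require Import structures.
From mathcomp Require Import all_boot all_order all_algebra.
From mathcomp Require Import all_classical all_reals all_analysis.

Set Implicit Arguments.
Unset Strict Implicit.
Unset Printing Implicit Defensive.

Import Order.TTheory GRing.Theory Num.Theory.
Import numFieldNormedType.Exports.

Local Open Scope classical_set_scope.
Local Open Scope ring_scope.

(* Vectors of R^n are row vectors. *)

Section Euclidean.
Context {R : realType} {n : nat}.
Implicit Types u v : 'rV[R]_n.

Definition dot u v : R := \sum_(i < n) u 0 i * v 0 i.

(* The library's norm on 'rV[R]_n is the sup norm; it induces the same
   topology, but the growth condition is stated with the Euclidean norm. *)
Definition enorm u : R := Num.sqrt (dot u u).

End Euclidean.

Section Smooth.
Context {R : realType} {n : nat}.
Implicit Types f : 'rV[R]_n -> R.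

Definition gradient f (x : 'rV[R]_n) : 'rV[R]_n :=
  \row_(i < n) 'd f x (delta_mx 0 i).

(* With row vectors the Jacobian is the transpose of the usual one, which leaves
   the quadratic form below unchanged. *)
Definition hessian f (x : 'rV[R]_n) : 'M[R]_n := 'J (gradient f) x.

Definition hessian_form f (x u : 'rV[R]_n) : R :=
  (u *m hessian f x *m u^T) 0 0.

Definition twice_continuously_differentiable f : Prop :=
  [/\ forall x, differentiable f x,
      forall x, differentiable (gradient f) x &
      continuous (hessian f)].

Definition twice_continuously_differentiable_map {m : nat}
    (F : 'rV[R]_n -> 'rV[R]_m) : Prop :=
  forall i : 'I_m, twice_continuously_differentiable (fun x => F x 0 i).

End Smooth.

Section ExtendedReal.
Context {R : realType} {n : nat}.
Implicit Types h : 'rV[R]_n -> \bar R.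
Local Open Scope ereal_scope.

Definition proper_function h : Prop :=
  (forall z, h z != -oo) /\ (exists z, h z \is a fin_num).

(* In both subderivatives q = (t, w') tends to (0+, w). *)
Definition subderivative h (z w : 'rV[R]_n) : \bar R :=
  limf_einf
    (fun q : R * 'rV[R]_n =>
       (h (z + q.1 *: q.2)%R - h z) * (q.1^-1)%:E)
    (filter_prod 0%R^'+ (nbhs w)).

Definition second_subderivative h (z zs w : 'rV[R]_n) : \bar R :=
  limf_einf
    (fun q : R * 'rV[R]_n =>
       (h (z + q.1 *: q.2)%R - h z - (q.1 * dot zs q.2)%:E)
       * ((2^-1 * q.1 ^+ 2)^-1)%:E)
    (filter_prod 0%R^'+ (nbhs w)).

Definition second_order_growth h (z0 : 'rV[R]_n) : Prop :=
  exists eps delta : R, [/\ (0 < eps)%R, (0 < delta)%R &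
    forall z, (enorm (z - z0) <= delta)%R ->
      h z0 + (eps * enorm (z - z0) ^+ 2)%:E <= h z].

Definition strict_local_minimizer h (z0 : 'rV[R]_n) : Prop :=
  \forall z \near z0^', h z0 < h z.

End ExtendedReal.

Section CompositeProblem.
Context {R : realType} {n m : nat}.
Variables (f0 : 'rV[R]_n -> R) (F : 'rV[R]_n -> 'rV[R]_m).
Variable g : 'rV[R]_m -> \bar R.

Definition composite_objective (x : 'rV[R]_n) : \bar R :=
  ((f0 x)%:E + g (F x))%E.

Definition lagrangian (x : 'rV[R]_n) (lambda : 'rV[R]_m) : R :=
  f0 x + dot lambda (F x).

Definition multipliers (x : 'rV[R]_n) : set 'rV[R]_m :=
  [set lambda | gradient (lagrangian^~ lambda) x = 0].

Definition critical_cone (x : 'rV[R]_n) : set 'rV[R]_n :=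
  [set u | ((dot (gradient f0 x) u)%:E
            + subderivative g (F x) ('d F x u) <= 0)%E].

End CompositeProblem.

(* Main.v *)
Require Import Defs.
From HB Require Import structures.
From mathcomp Require Import all_boot all_order all_algebra.
From mathcomp Require Import all_classical all_reals all_analysis.
From mathcomp Require Import ring lra.

Set Implicit Arguments.
Unset Strict Implicit.
Unset Printing Implicit Defensive.

Import Order.TTheory GRing.Theory Num.Theory.
Import numFieldNormedType.Exports.

Local Open Scope classical_set_scope.
Local Open Scope ring_scope.

(** Write phi = f0 + g o F and parametrise points near xbar as xbar + t u with
    t > 0 and u on the Euclidean unit sphere.  Growth is proved direction by
    direction: each unit vector u has some e > 0 such that
    phi(xbar + t u') >= phi(xbar) + e t^2 for (t, u') close to (0+, u).  As the
    sphere is compact, e and the range of t can then be chosen uniformly in the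
    direction ([second_order_growth_of_directions]).

    To see the bound in a direction u, put
    w(t, u') = (F(xbar + t u') - F(xbar)) / t.  Then
    F(xbar + t u') = F(xbar) + t w(t, u'), and w(t, u') tends to F'(xbar) u as
    (t, u') tends to (0+, u); hence a strict lower bound on a subderivative of g
    at F'(xbar) u is inherited by the corresponding quotient of g along F
    ([cvg_times_quotient], [limf_einf_gt]).

    - If u is not critical, the first-order quotients of phi are eventually
      bounded below by a positive constant c, so that phi grows at least like
      c t, which dominates c t^2 ([growth_along_noncritical]).
    - If u is critical, take the multiplier lambda given by the hypothesis.
      Since the gradient of L(., lambda) vanishes at xbar, the increment of phi
      is the second-order increment of L(., lambda) plus
      g(F(x)) - g(F(xbar)) - <lambda, F(x) - F(xbar)>.  After division by t^2/2
      the first tends to the Hessian form at u ([second_order_taylor]) and the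
      lower limit of the second is at least the second subderivative; the sum
      of the two is positive ([growth_along_critical]). *)

(** The neighbourhoods in the subderivatives are elaborated through the bare
    filtered structure of matrices, on which instance resolution does not find
    the topological one; the two are convertible. *)
#[local] Instance nbhs_rV_filter (R : realType) (n : nat) (u : 'rV[R]_n) :
  Filter (nbhs u).
Proof. exact: (nbhs_filter (u : ('rV[R]_n : normedModType R))). Qed.

(** * The Euclidean inner product *)

Section DotProduct.
Context {R : realType} {n : nat}.
Implicit Types u v w : 'rV[R]_n.

Lemma dotBl u v w : dot (u - v) w = dot u w - dot v w.
Proof. by rewrite /dot -sumrB; apply: eq_bigr => i _; rewrite !mxE mulrBl. Qed.

Lemma dotBr u v w : dot w (u - v) = dot w u - dot w v.
Proof. by rewrite /dot -sumrB; apply: eq_bigr => i _; rewrite !mxE mulrBr. Qed.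

Lemma dotZl (k : R) u v : dot (k *: u) v = k * dot u v.
Proof. by rewrite /dot mulr_sumr; apply: eq_bigr => i _; rewrite !mxE mulrA. Qed.

Lemma dotZr (k : R) u v : dot u (k *: v) = k * dot u v.
Proof. by rewrite /dot mulr_sumr; apply: eq_bigr => i _; rewrite !mxE mulrCA. Qed.

Lemma dot0l u : dot 0 u = 0.
Proof. by rewrite /dot big1 // => i _; rewrite mxE mul0r. Qed.

Lemma dot_sqr_ge0 u : 0 <= dot u u.
Proof. by apply: sumr_ge0 => i _; rewrite -expr2 sqr_ge0. Qed.

Lemma dot_sqr_eq0 u : dot u u = 0 -> u = 0.
Proof.
move=> /eqP; rewrite psumr_eq0 => [/allP u0|i _]; last by rewrite -expr2 sqr_ge0.
apply/rowP => i; have /= := u0 i (mem_index_enum _).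
by rewrite mulf_eq0 orbb mxE => /eqP.
Qed.

Lemma cvg_dot (T : Type) (G : set_system T) {FG : Filter G}
    (a b : T -> 'rV[R]_n) u v :
  a @ G --> u -> b @ G --> v -> dot (a x) (b x) @[x --> G] --> dot u v.
Proof.
move=> au bv; apply: cvg_big => [|i _]; first exact: add_continuous.
apply: cvgM.
  exact: (cvg_comp _ _ au (@coord_continuous R _ _ 0 i u)).
exact: (cvg_comp _ _ bv (@coord_continuous R _ _ 0 i v)).
Qed.

Lemma mulmx_trE (u v : 'rV[R]_n) : (u *m v^T) 0 0 = dot u v.
Proof. by rewrite mxE; apply: eq_bigr => i _; rewrite mxE. Qed.

Lemma enorm_ge0 u : 0 <= enorm u.
Proof. exact: sqrtr_ge0. Qed.

Lemma enorm_sqr u : enorm u ^+ 2 = dot u u.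
Proof. by rewrite sqr_sqrtr // dot_sqr_ge0. Qed.

Lemma enorm_gt0 u : (0 < enorm u) = (u != 0).
Proof.
rewrite sqrtr_gt0 lt_def dot_sqr_ge0 andbT; congr (~~ _).
by apply/eqP/eqP => [/dot_sqr_eq0//|->]; rewrite dot0l.
Qed.

Lemma dot_diag_continuous : continuous (fun u : 'rV[R]_n => dot u u).
Proof.
by move=> u; apply: cvg_dot; exact: cvg_id.
Qed.

Lemma enorm_continuous : continuous (@enorm R n).
Proof.
move=> u; apply: (@continuous_comp _ _ _ (fun v => dot v v) Num.sqrt).
  exact: dot_diag_continuous.
exact: sqrt_continuous.
Qed.

Lemma compact_unit_sphere : compact [set u : 'rV[R]_n | dot u u = 1].
Proof.
apply: bounded_closed_compact.
  exists 1; split => // M M1 u /= u1; apply: (le_trans _ (ltW M1)).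
  rewrite [leLHS]mx_normrE; apply/bigmax_leP; split => // -[i j] _ /=.
  rewrite -(@ler_pXn2r _ 2) ?nnegrE // expr1n real_normK ?num_real // (ord1 i) -u1.
  rewrite /dot (bigD1 j) //= -expr2 lerDl.
  by apply: sumr_ge0 => k _; rewrite -expr2 sqr_ge0.
rewrite (_ : [set _ | _] = (fun u : 'rV[R]_n => dot u u) @^-1` [set 1]) //.
apply: preimage_closed => [u _|]; first exact: dot_diag_continuous.
exact: closed_eq.
Qed.

End DotProduct.

(** * Limits along times tending to 0+ and converging directions *)

Lemma near_times_gt0 (R : realType) (V : topologicalType) (u : V) :
  \forall q \near filter_prod (0 : R)^'+ (nbhs u), 0 < q.1.
Proof. by apply: (@cvg_fst _ _ _ _ _ [set t | 0 < t]); exact: nbhs_right_gt. Qed.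

(** Differentiability gives the limit of the difference quotients jointly in the
    step and the direction, because the remainder o(t u') is o(t) while u' stays
    bounded. *)
Lemma cvg_directional_quotient (R : realType) (V W : normedModType R)
    (f : V -> W) (x u : V) : differentiable f x ->
  q.1^-1 *: (f (x + q.1 *: q.2) - f x)
    @[q --> filter_prod (0 : R)^'+ (nbhs u)] --> 'd f x u.
Proof.
move=> df; rewrite -[X in _ --> X]addr0.
pose o := (fun h : V => f (x + h) - f x - 'd f x h).
have oE e : 0 < e -> \forall h \near 0, `|o h| <= e * `|h|.
  move=> e0; have /funext/eqaddoP/(_ e e0) := diff_locallyxC df.
  by apply: filterS => h; rewrite /= opprD addrA.
have snd_u : q.2 @[q --> filter_prod (0 : R)^'+ (nbhs u)] --> u by exact: cvg_snd.
have fst_0 : q.1 @[q --> filter_prod (0 : R)^'+ (nbhs u)] --> (0 : R).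
  by apply: (cvg_trans cvg_fst); exact: cvg_within.
have tu0 : q.1 *: q.2 @[q --> filter_prod (0 : R)^'+ (nbhs u)] --> (0 : V).
  by rewrite -(scale0r u); exact: cvgZ.
have o0 : q.1^-1 *: o (q.1 *: q.2)
    @[q --> filter_prod (0 : R)^'+ (nbhs u)] --> (0 : W).
  apply/cvgr0Pnorm_le => e e0.
  have M0 : 0 < `|u| + 1 by rewrite ltr_wpDl.
  have norm_le : \forall q \near filter_prod (0 : R)^'+ (nbhs u),
      `|q.2| <= `|u| + 1 by apply: (cvgr_norm_le _ snd_u); rewrite ltrDl.
  have e'0 : 0 < e / (`|u| + 1) by rewrite divr_gt0.
  near=> q.
  have q0 : 0 < q.1 by near: q; exact: near_times_gt0.
  rewrite normrZ gtr0_norm ?invr_gt0 // ler_pdivrMl //.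
  have : `|o (q.1 *: q.2)| <= e / (`|u| + 1) * `|q.1 *: q.2|.
    by near: q; exact: (tu0 _ (oE _ e'0)).
  move=> /le_trans; apply; rewrite normrZ gtr0_norm // mulrCA ler_pM2l //.
  rewrite mulrAC ler_pdivrMr // ler_pM2l //.
  by near: q.
have dfu : 'd f x v @[v --> u] --> 'd f x u by exact: diff_continuous.
have lim_sum : 'd f x q.2 + q.1^-1 *: o (q.1 *: q.2)
    @[q --> filter_prod (0 : R)^'+ (nbhs u)] --> 'd f x u + 0.
  by apply: cvgD o0; exact: (cvg_comp _ _ snd_u dfu).
apply: (cvg_trans _ lim_sum); apply: near_eq_cvg; near=> q.
have q0 : 0 < q.1 by near: q; exact: near_times_gt0.
apply: (scalerI (lt0r_neq0 q0)); rewrite /= /o linearZ /=.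
by rewrite scalerDr !scalerA divff ?gt_eqF // !scale1r addrC subrK.
Unshelve. all: by end_near. Qed.

Lemma limf_einf_gt (T : choiceType) (X : filteredType T) (R : realType)
    (h : X -> \bar R) (G : set_system X) {FG : Filter G} (a : \bar R) :
  (a < limf_einf h G)%E -> \forall x \near G, (a < h x)%E.
Proof.
rewrite limf_einfE => /ereal_sup_gt[_ [A GA <-] aA].
apply: filterS GA => x Ax; apply: (lt_le_trans aA).
by apply: ereal_inf_lbound; exists x.
Qed.

(** A strict inequality leaves a real margin c, also when d is infinite; the
    margin is what later becomes the growth constant. *)
Lemma lte_adde_margin (R : realType) (a : R) (d : \bar R) :
  (0 < a%:E + d)%E -> exists2 c, 0 < c & ((c - a)%:E < d)%E.
Proof.
case: d => [r|_|//]; last by exists 1; rewrite ?ltry.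
rewrite -EFinD lte_fin => ar; exists ((a + r) / 2); first by rewrite divr_gt0.
by rewrite lte_fin; lra.
Qed.

(** * Gradients and the second-order expansion *)

Section Gradient.
Context {R : realType} {n : nat}.
Implicit Types (f : 'rV[R]_n -> R) (x u : 'rV[R]_n).

Lemma dot_gradient f x u : differentiable f x ->
  dot (gradient f x) u = 'd f x u.
Proof.
move=> df; rewrite [in RHS](row_sum_delta u) linear_sum.
by apply: eq_bigr => i _; rewrite linearZ /= mxE mulrC.
Qed.

Lemma hessian_formE f x u :
  hessian_form f x u = dot ('d (gradient f) x u) u.
Proof. by rewrite /hessian_form /hessian /jacobian mul_rV_lin1 mulmx_trE. Qed.

Definition twice_differentiable f :=
  (forall x, differentiable f x) /\ (forall x, differentiable (gradient f) x).

Lemma twice_differentiableD f g : twice_differentiable f ->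
  twice_differentiable g -> twice_differentiable (f + g).
Proof.
move=> [df ddf] [dg ddg]; split => x; first exact: differentiableD.
suff -> : gradient (f + g) = gradient f + gradient g by exact: differentiableD.
by apply/funext => y; apply/rowP => i; rewrite !mxE diffD.
Qed.

Lemma twice_differentiableZ (k : R) f : twice_differentiable f ->
  twice_differentiable (k *: f).
Proof.
move=> [df ddf]; split => x; first exact: differentiableZ.
suff -> : gradient (k *: f) = k *: gradient f by exact: differentiableZ.
by apply/funext => y; apply/rowP => i; rewrite !mxE diffZ.
Qed.

Lemma twice_differentiable0 : twice_differentiable 0.
Proof.
have d0 x : 'd (0 : 'rV[R]_n -> R) x = 0 :> (_ -> _) by exact: diff_cst.
split => x; first exact: differentiable_cst.
suff -> : gradient 0 = cst 0 :> ('rV[R]_n -> 'rV[R]_n) by exact: differentiable_cst.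
by apply/funext => y; apply/rowP => i; rewrite !mxE d0.
Qed.

(** The mean value theorem is applied in the variable t, for a fixed direction v
    near u.  The derivative of the remainder psi at c is c times the difference
    between the quotient <grad f(x + c v) - grad f(x), v> / c and its limit Q,
    and this difference is small by differentiability of the gradient at x. *)
Lemma second_order_taylor f x u : twice_differentiable f -> forall e : R, 0 < e ->
  \forall q \near filter_prod (0 : R)^'+ (nbhs u),
  `| f (x + q.1 *: q.2) - f x - q.1 * dot (gradient f x) q.2
     - 2^-1 * q.1 ^+ 2 * hessian_form f x u | <= e * q.1 ^+ 2.
Proof.
move=> [df ddf] e e0; rewrite hessian_formE.
set Q := dot _ u.
have snd_u : q.2 @[q --> filter_prod (0 : R)^'+ (nbhs u)] --> u by exact: cvg_snd.
have dQ : dot (q.1^-1 *: (gradient f (x + q.1 *: q.2) - gradient f x)) q.2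
    @[q --> filter_prod (0 : R)^'+ (nbhs u)] --> Q.
  by apply: cvg_dot snd_u; exact: cvg_directional_quotient.
(* A and B are the times and directions for which the quotient is e-close. *)
have [[A B] /= [A0 Bu] AB] := cvgr_distC_le _ _ dQ e e0.
have [d /= d0 dA] := A0.
exists ([set t | 0 < t /\ t < d], B).
  by split => //=; apply: filterI; [exact: nbhs_right_gt|exact: nbhs_right_lt].
move=> [t v] /= [[t0 td] Bv].
pose psi (s : R) := f (x + s *: v) - f x - s * dot (gradient f x) v
                    - 2^-1 * s ^+ 2 * Q.
pose dpsi (s : R) := dot (gradient f (x + s *: v) - gradient f x) v - s * Q.
have psi' (s : R) : is_derive s 1 psi (dpsi s).
  have line_diff : is_diff s (fun r : R => x + r *: v) ( *:%R ^~ v).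
    by apply: is_diff_eq; rewrite add0r.
  have fline : is_derive s 1 (fun r : R => f (x + r *: v))
                 (dot (gradient f (x + s *: v)) v).
    have dfl := differentiableP (df (x + s *: v)).
    have [dcomp vcomp] := is_diff_comp line_diff dfl.
    apply: DeriveDef; first exact: diff_derivable.
    by rewrite deriveE // vcomp /= scale1r dot_gradient.
  rewrite /dpsi dotBl; apply: is_derive_eq.
  rewrite !scaler0 !add0r subr0 /GRing.scale /= !mulr1.
  congr (_ - _); rewrite -mulr2n -[s *+ 2]mulr_natl mulKf ?pnatr_eq0 //.
  exact: mulrC.
have [c c0t] : exists2 c, c \in `]0, t[%R & psi t - psi 0 = dpsi c * (t - 0).
  apply: MVT => //.
  apply: continuous_subspaceT => s; apply: differentiable_continuous.
  by apply/derivable1_diffP; case: (psi' s).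
have -> : psi 0 = 0 by rewrite /psi scale0r addr0; ring.
rewrite !subr0 => psit; move: c0t; rewrite in_itv /= => /andP[c0 ct].
suff : `|psi t| <= e * t ^+ 2 by [].
have Ac : A c.
  by apply: dA => //=; rewrite sub0r normrN gtr0_norm // (lt_trans ct).
have := AB (c, v) (conj Ac Bv) => /=; rewrite dotZl => dc.
rewrite psit; have -> : dpsi c =
    c * (c^-1 * dot (gradient f (x + c *: v) - gradient f x) v - Q).
  by rewrite /dpsi mulrBr mulVKf ?gt_eqF.
rewrite !normrM (gtr0_norm c0) (gtr0_norm t0) expr2 mulrA ler_pM2r //.
by rewrite mulrC; apply: ler_pM => //; exact: ltW.
Qed.

End Gradient.

Lemma lagrangian_twice_differentiable (R : realType) (n m : nat)
    (f0 : 'rV[R]_n -> R) (F : 'rV[R]_n -> 'rV[R]_m) (lambda : 'rV[R]_m) :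
  twice_continuously_differentiable f0 ->
  twice_continuously_differentiable_map F ->
  twice_differentiable (lagrangian f0 F ^~ lambda).
Proof.
move=> [df0 ddf0 _] dF.
rewrite (_ : lagrangian _ _ ^~ _ =
    f0 + \sum_(i < m) lambda 0 i *: (fun x => F x 0 i)); last first.
  apply/funext => x; rewrite /lagrangian /dot [in RHS]/GRing.add /= fct_sumE.
  by [].
apply: twice_differentiableD => //.
elim/big_ind : _ => [||i _]; first exact: twice_differentiable0.
  exact: twice_differentiableD.
by apply: twice_differentiableZ; case: (dF i).
Qed.

Lemma differentiable_of_coords (R : realType) (n m : nat)
    (F : 'rV[R]_n -> 'rV[R]_m) (x : 'rV[R]_n) :
  (forall i, differentiable (fun y => F y 0 i) x) -> differentiable F x.
Proof.
move=> dF.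
rewrite (_ : F = \sum_(i < m) (fun y => F y 0 i *: (delta_mx 0 i : 'rV[R]_m))).
  by apply: differentiable_sum => i; exact: differentiableZl.
by apply/funext => y; rewrite fct_sumE [LHS]row_sum_delta.
Qed.

(** * From directional growth to second-order growth *)

Section SecondOrderGrowth.
Context {R : realType} {n : nat}.
Context (h : 'rV[R]_n -> \bar R) (x : 'rV[R]_n).
Local Open Scope ereal_scope.

(** The same number s serves as growth constant and as bound on the times, which
    makes the estimate P s u monotone in s.  It holds for s small and directions
    close to u, so the covering property of the compact sphere, used with the
    filter of positive s tending to 0, gives one s for all directions. *)
Lemma second_order_growth_of_directions :
  (forall u, dot u u = 1%R -> exists2 e : R, (0 < e)%R &
    \forall q \near filter_prod (0%R : R)^'+ (nbhs u),
      h x + (e * q.1 ^+ 2)%:E <= h (x + q.1 *: q.2)%R) ->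
  second_order_growth h x.
Proof.
move=> dirs.
pose P (s : R) (u : 'rV[R]_n) := forall t : R, (0 < t <= s)%R ->
  h x + (s * t ^+ 2)%:E <= h (x + t *: u)%R.
have cover (u : 'rV[R]_n) : [set u : 'rV[R]_n | dot u u = 1%R] u ->
    \forall v \near u & s \near (0%R : R)^'+, P s v.
  move=> /dirs [e e0 [[A B] /= [[d /= d0 dA] Bu] AB]].
  exists (B, [set s : R | (s <= e)%R /\ (s < d)%R]).
    split => //=; apply: filterI; last exact: nbhs_right_lt.
    exact: nbhs_right_le.
  move=> [v s] /= [Bv [se sd]] t /andP[t0 ts].
  have At : A t.
    by apply: dA => //=; rewrite sub0r normrN gtr0_norm // (le_lt_trans ts).
  apply: le_trans (AB (t, v) (conj At Bv)).
  by rewrite leeD2l // lee_fin ler_wpM2r // sqr_ge0.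
have sphere : \forall s \near (0%R : R)^'+, [set u | dot u u = 1%R] `<=` P s.
  exact: ((compact_near_coveringP _).1 compact_unit_sphere).
have [s [s0 Ps]] := filter_ex (filterI (nbhs_right_gt 0%R) sphere).
exists s, s; split => // z zs.
have [->|zx] := eqVneq z x.
  by rewrite subrr /enorm dot0l sqrtr0 expr0n /= mulr0 adde0.
have r0 : (0 < enorm (z - x))%R by rewrite enorm_gt0 subr_eq0.
have := Ps ((enorm (z - x))^-1 *: (z - x))%R _ (enorm (z - x)).
rewrite scalerA divff ?gt_eqF // scale1r [(x + _)%R]addrC subrK.
apply; last by rewrite r0 /=.
by rewrite /= dotZl dotZr -enorm_sqr expr2 mulKf ?mulVf ?gt_eqF.
Qed.

Lemma strict_local_minimizer_of_growth : h x \is a fin_num ->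
  second_order_growth h x -> strict_local_minimizer h x.
Proof.
move=> hx [e [d [e0 d0 growth]]].
have small : \forall z \near x, (enorm (z - x) <= d)%R.
  have cont : enorm (z - x) @[z --> x] --> (0%R : R).
    have -> : 0%R = enorm (x - x) :> R by rewrite subrr /enorm dot0l sqrtr0.
    apply: (cvg_comp (fun z => z - x)%R (@enorm R n)); last exact: enorm_continuous.
    by apply: cvgB; [exact: cvg_id|exact: cvg_cst].
  apply: filterS (cvgr_norm_le _ cont d _) => [z|]; last by rewrite normr0.
  by rewrite ger0_norm // enorm_ge0.
apply: filterS small => z zd /= zx.
apply: lt_le_trans (growth z zd).
by rewrite lteDl // lte_fin mulr_gt0 // exprn_gt0 // enorm_gt0 subr_eq0.
Qed.

End SecondOrderGrowth.

(** * Growth of the composite objective along a direction *)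

Section CompositeDirections.
Context {R : realType} {n m : nat}.
Context (f0 : 'rV[R]_n -> R) (F : 'rV[R]_n -> 'rV[R]_m).
Context (g : 'rV[R]_m -> \bar R) (x u : 'rV[R]_n).
Context (F_diff : differentiable F x).
Context (g_gtNy : forall z, g z != -oo%E).
Context (g_fin : g (F x) \is a fin_num).

(** The change of variables (t, u') |-> (t, w) with F (x + t u') = F x + t w. *)
Let times_quotient (q : R * 'rV[R]_n) :=
  (q.1, q.1^-1 *: (F (x + q.1 *: q.2) - F x)).

Lemma cvg_times_quotient :
  times_quotient @ filter_prod (0 : R)^'+ (nbhs u) -->
    filter_prod (0 : R)^'+ (nbhs ('d F x u)).
Proof. exact: (cvg_pair cvg_fst (cvg_directional_quotient F_diff)). Qed.

Lemma times_quotientK q : 0 < q.1 ->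
  F x + (times_quotient q).1 *: (times_quotient q).2 = F (x + q.1 *: q.2).
Proof. by move=> q0; rewrite scalerA divff ?gt_eqF // scale1r addrC subrK. Qed.

Lemma growth_along_noncritical : differentiable f0 x ->
  (0 < (dot (gradient f0 x) u)%:E + subderivative g (F x) ('d F x u))%E ->
  exists2 e : R, 0 < e & \forall q \near filter_prod (0 : R)^'+ (nbhs u),
    (composite_objective f0 F g x + (e * q.1 ^+ 2)%:E
     <= composite_objective f0 F g (x + q.1 *: q.2))%E.
Proof.
move=> f0_diff; rewrite dot_gradient // => /lte_adde_margin[c c0 cg].
(* The smooth part may lose half of the margin c. *)
exists (c / 2); first by rewrite divr_gt0.
have g_quot := cvg_times_quotient (limf_einf_gt cg).
have c20 : 0 < c / 2 by rewrite divr_gt0.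
have f_quot := cvgr_distC_le _ _ (cvg_directional_quotient (u := u) f0_diff) _ c20.
near=> q.
have q0 : 0 < q.1 by near: q; exact: near_times_gt0.
have q1 : q.1 <= 1.
  by near: q; apply: (@cvg_fst _ _ _ _ _ [set t | t <= 1]); exact: nbhs_right_le.
have gq : ((c - 'd f0 x u)%:E < (g (F (x + q.1 *: q.2)) - g (F x)) * (q.1^-1)%:E)%E.
  by rewrite -times_quotientK //; near: q; exact: g_quot.
have fq : `|q.1^-1 *: (f0 (x + q.1 *: q.2) - f0 x) - 'd f0 x u| <= c / 2.
  by near: q; exact: f_quot.
rewrite /composite_objective; move: (g_gtNy (F (x + q.1 *: q.2))) g_fin gq.
case: (g (F x)) => // r0; case: (g _) => // [r|] _ _; last by rewrite leey.
rewrite -EFinB -EFinM lte_fin ltr_pdivlMr // -!EFinD lee_fin => gq.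
have {}fq : 'd f0 x u - c / 2 <= (f0 (x + q.1 *: q.2) - f0 x) / q.1.
  move: fq; rewrite ler_distlC => /andP[]; rewrite lerBlDr [_ / q.1]mulrC.
  by rewrite lerBlDr.
move: fq; rewrite ler_pdivlMr // => fq.
(* For times below 1 linear growth dominates quadratic growth. *)
have : c / 2 * q.1 ^+ 2 <= c / 2 * q.1 by rewrite ler_pM2l // expr2 ger_pMl.
by nra.
Unshelve. all: by end_near. Qed.

Lemma growth_along_critical lambda :
  twice_differentiable (lagrangian f0 F ^~ lambda) ->
  multipliers f0 F x lambda ->
  (0 < (hessian_form (lagrangian f0 F ^~ lambda) x u)%:E
       + second_subderivative g (F x) lambda ('d F x u))%E ->
  exists2 e : R, 0 < e & \forall q \near filter_prod (0 : R)^'+ (nbhs u),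
    (composite_objective f0 F g x + (e * q.1 ^+ 2)%:E
     <= composite_objective f0 F g (x + q.1 *: q.2))%E.
Proof.
move=> L_diff L_crit; set a := hessian_form _ _ _ => /lte_adde_margin[c c0 cg].
have c40 : 0 < c / 4 by rewrite divr_gt0.
(* The margin contributes c t^2 / 2, of which the expansion of the Lagrangian
   may lose c t^2 / 4. *)
exists (c / 4) => //.
have g_quot := cvg_times_quotient (limf_einf_gt cg).
have L_taylor := second_order_taylor x u L_diff c40.
near=> q.
have q0 : 0 < q.1 by near: q; exact: near_times_gt0.
have q20 : 0 < 2^-1 * q.1 ^+ 2 by rewrite mulr_gt0 // exprn_gt0.
have gq : ((c - a)%:E < (g (F (x + q.1 *: q.2)) - g (F x)
    - (q.1 * dot lambda (times_quotient q).2)%:E) * ((2^-1 * q.1 ^+ 2)^-1)%:E)%E.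
  by rewrite -times_quotientK //; near: q; exact: g_quot.
have : `|lagrangian f0 F (x + q.1 *: q.2) lambda - lagrangian f0 F x lambda
         - q.1 * dot (gradient (lagrangian f0 F ^~ lambda) x) q.2
         - 2^-1 * q.1 ^+ 2 * a| <= c / 4 * q.1 ^+ 2.
  by near: q; exact: L_taylor.
rewrite L_crit dot0l mulr0 subr0 ler_norml /lagrangian => /andP[Lq _].
move: gq; rewrite /= dotZr mulVKf ?gt_eqF // dotBr.
rewrite /composite_objective; move: (g_gtNy (F (x + q.1 *: q.2))) g_fin.
case: (g (F x)) => // r0; case: (g _) => // [r|] _ _; last by rewrite leey.
rewrite -!EFinB -EFinM lte_fin ltr_pdivlMr // -!EFinD lee_fin => gq.
set l1 := dot lambda (F x) in Lq gq; set l2 := dot lambda _ in Lq gq.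
by nra.
Unshelve. all: by end_near. Qed.

End CompositeDirections.

Theorem theorem6p1 (R : realType) (n m : nat)
    (f0 : 'rV[R]_n -> R) (F : 'rV[R]_n -> 'rV[R]_m)
    (g : 'rV[R]_m -> \bar R) (xbar : 'rV[R]_n)
    (f0_C2 : twice_continuously_differentiable f0)
    (F_C2 : twice_continuously_differentiable_map F)
    (g_proper : proper_function g) (g_lsc : lower_semicontinuous g)
    (g_fin : g (F xbar) \is a fin_num)
    (second_order_condition :
      forall u : 'rV[R]_n, critical_cone f0 F g xbar u -> u != 0 ->
      exists2 lambda : 'rV[R]_m, multipliers f0 F xbar lambda &
        (0 < (hessian_form (fun x => lagrangian f0 F x lambda) xbar u)%:E
             + second_subderivative g (F xbar) lambda ('d F xbar u))%E) :
  second_order_growth (composite_objective f0 F g) xbar /\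
  strict_local_minimizer (composite_objective f0 F g) xbar.
Proof.
have [g_gtNy _] := g_proper.
have F_diff : differentiable F xbar.
  by apply: differentiable_of_coords => i; have [] := F_C2 i.
have growth : second_order_growth (composite_objective f0 F g) xbar.
  apply: second_order_growth_of_directions => u u1.
  have u0 : u != 0.
    by apply/eqP => u0; move/eqP: u1; rewrite u0 dot0l eq_sym oner_eq0.
  have [crit|/negP] := boolP ((dot (gradient f0 xbar) u)%:E
      + subderivative g (F xbar) ('d F xbar u) <= 0)%E.
    have [lambda L_crit pos] := second_order_condition u crit u0.
    apply: growth_along_critical L_crit pos => //.
    exact: lagrangian_twice_differentiable.
  move/negP; rewrite -ltNge; apply: growth_along_noncritical => //.
  by have [] := f0_C2.
split => //; apply: strict_local_minimizer_of_growth => //.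
by rewrite /composite_objective fin_numD.
Qed.
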